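(* For every integer $n\ge 3$, the number of spanning trees of $M_n$ is $$\tau(M_n)=\frac{n}{2}\,(p^{n}+q^{n}+2).$$
   Context: For an integer $n\ge 3$, the Möbius polyomino network $M_n$ is the graph with vertex set $\{1,\dots,n\}\cup\{1',\dots,n'\}$ whose edges are $\{i,i+1\}$ and $\{i',(i+1)'\}$ for $1\le i\le n-1$, $\{i,i'\}$ for $1\le i\le n$, and the two edges $\{1,n'\}$ and $\{1',n\}$. $p=2+\sqrt3$, $q=2-\sqrt3$. $\tau(G)$ denotes the number of spanning trees of $G$. *)

(* Defs.v *)
From mathcomp Require Import all_boot all_order all_algebra.
From mathcomp Require Import boolp.
Set Implicit Arguments. Unset Strict Implicit. Unset Printing Implicit Defensive.

(* Vertices of M_n: (i, false) is the vertex i+1, (i, true) is the vertex (i+1)'. *)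
Definition mvert (n : nat) : finType := ('I_n * bool)%type.

Definition madj (n : nat) : rel (mvert n) := fun u v =>
  let: (i, a) := u in let: (j, b) := v in
  [|| (a == b) && ((i.+1 == j :> nat) || (j.+1 == i :> nat)),
      (i == j) && (a != b)
    | (a != b) && (((i == 0 :> nat) && (j == n.-1 :> nat))
                   || ((j == 0 :> nat) && (i == n.-1 :> nat)))].   (* {1,n'}, {1',n} *)

Definition edges (V : finType) (adj : rel V) : {set {set V}} :=
  [set [set u; v] | u in V, v in V & adj u v].

Definition subadj (V : finType) (T : {set {set V}}) : rel V :=
  fun u v => (u != v) && ([set u; v] \in T).

Definition is_spanning_tree (V : finType) (adj : rel V) (T : {set {set V}}) : Prop :=
  [/\ T \subset edges adj,
      (forall u v : V, connect (subadj T) u v) &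
      (forall c : seq V, uniq c -> 3 <= size c -> ~~ cycle (subadj T) c)].

Definition tau (V : finType) (adj : rel V) : nat :=
  #|[set T : {set {set V}} | `[< is_spanning_tree adj T >]]|.

(* Main.v *)
(* A spanning tree rooted at r is a parent function F, so expanding det of the
   Laplacian (root row replaced by a unit vector) along all its rows gives the
   number of spanning trees: det (1 - P_F) is 1 if F flows to r and 0 otherwise.
   Replacing this minor by det (L + cJ) = c |V|^2 tau keeps the symmetry of the
   graph: exchanging i and i' splits L + cJ into 2 - S - S^T + 2cJ and
   4 - W - W^T, where S and W are the periodic and antiperiodic shifts of length
   n.  With 2c = n the first is (1 - S + J)(1 - S + J)^T, of determinant n^4, and
   the second is p (1 - qW)(1 - qW)^T, of determinant
   p^n (1 + q^n)^2 = p^n + q^n + 2. *)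
Require Import Defs.
From mathcomp Require Import all_boot all_order all_algebra.
From mathcomp Require Import perm boolp ring zify.
Import Order.TTheory GRing.Theory Num.Theory.
Set Implicit Arguments. Unset Strict Implicit. Unset Printing Implicit Defensive.

(** * Spanning trees as parent functions *)

Lemma set2_inj (T : finType) (a b c d : T) :
  [set a; b] = [set c; d] -> (a = c /\ b = d) \/ (a = d /\ b = c).
Proof.
move=> E.
have [] := (set21 a b, set22 a b); rewrite E !inE => Ha Hb.
have [] := (set21 c d, set22 c d); rewrite -E !inE => Hc Hd.
case/orP: Ha => /eqP ?; case/orP: Hb => /eqP ?; subst; auto.
- by move: Hd; rewrite orbb => /eqP ->; left.
- by move: Hc; rewrite orbb => /eqP ->; left.
Qed.

(** Fixing [r] leaves no free choice at the root, so each spanning tree corresponds to exactly one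
    [F]; reaching [r] from everywhere forbids any other cycle. *)
Definition parent_map (V : finType) (adj : rel V) (r : V) (F : {ffun V -> V}) :=
  [&& F r == r, [forall v, (v != r) ==> adj v (F v)] & [forall v, fconnect F v r]].

Definition parent_edges (V : finType) (r : V) (F : V -> V) : {set {set V}} :=
  [set [set v; F v] | v in [pred v | v != r]].

(** The rank is the least number of steps to [r]; it is the induction measure wherever acyclicity
    matters. *)
Lemma fconnect_rank (V : finType) (r : V) (F : V -> V) :
  (forall v, fconnect F v r) -> exists d : V -> nat, forall v, v != r -> d (F v) < d v.
Proof.
move=> H.
have E v : exists k, iter k F v == r.
  by exists (findex F v r); rewrite iter_findex.
exists (fun v => ex_minn (E v)) => v vr.
case: ex_minnP => k _ kmin; case: ex_minnP => -[|j]; first by rewrite /= (negPf vr).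
by rewrite iterSr => /kmin.
Qed.

Lemma rank_fconnect (V : finType) (r : V) (F : V -> V) (d : V -> nat) :
  (forall v, v != r -> d (F v) < d v) -> forall v, fconnect F v r.
Proof.
move=> dF v; have [k] := ubnP (d v); elim: k v => // k IH v dv.
case: (eqVneq v r) => [-> //|vr].
apply: connect_trans (fconnect1 F v) (IH _ _).
exact: leq_trans (dF _ vr) dv.
Qed.

Lemma connect_rank (V : finType) (e : rel V) (r : V) :
  (forall v, connect e v r) ->
  exists d : V -> nat, forall v, v != r -> exists2 u, e v u & d u < d v.
Proof.
move=> H.
(* The rank is the length of a shortest path; tuples of fixed length keep the predicate boolean, as
   [ex_minn] requires. *)
have E v : exists k, [exists p : k.-tuple V, path e v p && (last v p == r)].
  have /connectP [p pp lp] := H v; exists (size p); apply/existsP.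
  by exists (in_tuple p); rewrite pp -lp eqxx.
exists (fun v => ex_minn (E v)) => v vr.
case: (ex_minnP (E v)) => -[|k] /existsP [p].
  by rewrite (tuple0 p) /= (negPf vr).
case/tupleP: p => u p /= /andP [/andP [vu up] lp] _.
exists u => //; case: ex_minnP => j _; apply.
by apply/existsP; exists p; rewrite up.
Qed.

Section ParentMaps.
Variables (V : finType) (adj : rel V) (r : V).
Hypotheses (adj_sym : symmetric adj) (adj_irr : irreflexive adj).

Lemma subadj_sym (T : {set {set V}}) : symmetric (subadj T).
Proof. by move=> u v; rewrite /subadj eq_sym setUC. Qed.

Lemma mem_edges (u v : V) : ([set u; v] \in edges adj) = adj u v.
Proof.
apply/imset2P/idP => [[x y _]|uv]; last by exists u v; rewrite ?inE.
by rewrite inE => /andP [_ xy] /set2_inj [[-> ->]|[-> ->]] //; rewrite adj_sym.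
Qed.

Lemma parent_edges_connect (F : V -> V) :
  (forall v, v != r -> F v != v) -> (forall v, fconnect F v r) ->
  forall u v, connect (subadj (parent_edges r F)) u v.
Proof.
move=> Fv Fr.
suff H v : connect (subadj (parent_edges r F)) v r.
  move=> u v; apply: connect_trans (H u) _.
  by rewrite (sym_connect_sym (@subadj_sym _)).
have [d dF] := fconnect_rank Fr.
have [k] := ubnP (d v); elim: k v => // k IH v dv.
case: (eqVneq v r) => [-> //|vr].
apply: (@connect_trans _ _ (F v)); last first.
  by apply: IH; apply: leq_trans (dF _ vr) dv.
apply: connect1; rewrite /subadj eq_sym Fv //=.
by apply/imsetP; exists v.
Qed.

Lemma subadj_parent_edges (F : V -> V) u v :
  subadj (parent_edges r F) u v ->
  (u != r) && (v == F u) || (v != r) && (u == F v).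
Proof.
case/andP=> _ /imsetP [w]; rewrite inE => wr /set2_inj [[-> ->]|[-> ->]];
by rewrite wr eqxx ?orbT.
Qed.

(* In a cycle, both neighbours of a vertex of maximal rank are its parent. *)
Lemma parent_edges_acyclic (F : V -> V) :
  (forall v, fconnect F v r) ->
  forall c : seq V, uniq c -> 3 <= size c -> ~~ cycle (subadj (parent_edges r F)) c.
Proof.
move=> /fconnect_rank [d dF] c cu c3; apply/negP => cc.
have [v vc vmax] : exists2 v, v \in c & forall w, w \in c -> d w <= d v.
  case: c c3 {cu cc} => // x c _.
  case: (@arg_maxnP _ x (mem (x :: c)) d); first exact: mem_head.
  by move=> v vc vm; exists v.
have nb w : w \in c -> subadj (parent_edges r F) v w -> w = F v.
  move=> wc /subadj_parent_edges /orP [/andP [_ /eqP //]|/andP [wr /eqP E]].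
  by have := dF _ wr; rewrite -E ltnNge vmax.
have [i c' E] := rot_to vc.
move: cc cu c3; rewrite -(rot_cycle i) -(rot_uniq i) -(size_rot i).
have {}nb w : w \in rot i c -> subadj (parent_edges r F) v w -> w = F v.
  by rewrite mem_rot; apply: nb.
move: nb; rewrite E; case: c' {E} => // a c'; case/lastP: c' => // c' b nb.
rewrite /= rcons_path last_rcons (subadj_sym _ b v) mem_rcons inE.
case/and3P=> va _ vb /and3P [_ + _] _.
have -> : a = F v by apply: nb; rewrite // !inE eqxx orbT.
have -> : b = F v by apply: nb; rewrite // !inE mem_rcons mem_head !orbT.
by rewrite eqxx.
Qed.

(** Induction on the rank for [F]: if [F v] and [G v] differ, the edge from [v] to [F v] comes from
    [w = F v] with [G w = v]. Then [F w = v] by induction, and the rank drops both from [v] to [w]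
    and from [w] to [v]. *)
Lemma parent_edges_inj :
  {in parent_map adj r &, injective (parent_edges r : {ffun V -> V} -> _)}.
Proof.
move=> F G /and3P [/eqP Fr /forallP Fa /forallP FF] /and3P [/eqP Gr _ _] E.
have [d dF] := fconnect_rank FF.
apply/ffunP => v; have [k] := ubnP (d v); elim: k v => // k IH v dv.
case: (eqVneq v r) => [->|vr]; first by rewrite Fr Gr.
have : [set v; F v] \in parent_edges r G by rewrite -E; apply/imsetP; exists v.
case/imsetP => w; rewrite inE => wr /set2_inj [[-> ->] //|[Ev Ew]].
have dw := dF _ vr; rewrite Ew in dw.
have Fw : F w = v by rewrite (IH w) ?Ev // (leq_trans dw).
by have := dF _ wr; rewrite Fw ltnNge ltnW.
Qed.

Lemma parent_edges_spanning (F : {ffun V -> V}) :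
  F \in parent_map adj r -> is_spanning_tree adj (parent_edges r F).
Proof.
case/and3P => /eqP Fr /forallP Fa /forallP FF; split.
- apply/subsetP => _ /imsetP [v vr ->]; rewrite mem_edges.
  exact: (implyP (Fa v)).
- apply: parent_edges_connect => // v vr; apply/eqP => E.
  by have := implyP (Fa v) vr; rewrite E adj_irr.
- exact: parent_edges_acyclic.
Qed.

Lemma spanning_parent_edges (T : {set {set V}}) : is_spanning_tree adj T ->
  exists2 F : {ffun V -> V}, F \in parent_map adj r & T = parent_edges r F.
Proof.
case=> Tadj Tconn Tac.
have [d dP] := connect_rank (Tconn^~ r).
(* Each vertex other than [r] picks a [T]-neighbour of smaller rank; [dP] provides one, so the
   default of [odflt] is never taken. *)
pose F : {ffun V -> V} :=
  [ffun v => if v == r then r else odflt r [pick u | subadj T v u && (d u < d v)]].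
have FP v : v != r -> subadj T v (F v) && (d (F v) < d v).
  move=> vr; rewrite ffunE (negPf vr); case: pickP => //= H.
  by have [u vu du] := dP v vr; have := H u; rewrite vu du.
have FF : forall v, fconnect F v r.
  by apply: (@rank_fconnect _ _ _ d) => v /FP /andP [].
have FT : parent_edges r F \subset T.
  by apply/subsetP => _ /imsetP [v vr ->]; have /andP [/andP []] := FP v vr.
have FA : F \in parent_map adj r.
  apply/and3P; split; first by rewrite ffunE eqxx.
    apply/forallP => v; apply/implyP => /FP /andP [/andP [_ /(subsetP Tadj)]].
    by rewrite mem_edges.
  by apply/forallP.
exists F => //; apply/eqP; rewrite eqEsubset FT andbT; apply/subsetP => t tT.
have /imset2P [x y _ ] := subsetP Tadj _ tT; rewrite inE => /andP [_ xy] Et.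
rewrite {t}Et in tT *.
have xNy : x != y by apply: contraTneq xy => ->; rewrite adj_irr.
have [_ Fconn _] := parent_edges_spanning FA.
(* An edge xy of [T] that is no parent edge would close the simple path of parent edges from [x] to
   [y] into a cycle of [T]. That path has at least two edges, so the cycle has at least three
   vertices. *)
apply: contraT => xyF.
have /connectP [p0 pp0] := Fconn x y; case/shortenP: pp0 => p pp pu _ Ey.
have /negP[] : ~~ cycle (subadj T) (x :: p).
  apply: Tac => //; case: p pp Ey {pu} => [|z [|z' p]] //=.
    by move=> _ E; rewrite E eqxx in xNy.
  by move=> + E; rewrite -E => /andP [/andP [_]]; rewrite (negPf xyF).
rewrite /= rcons_path -Ey subadj_sym; apply/andP; split; last by rewrite /subadj xNy.
apply: sub_path pp => u v /andP [uv uvF]; rewrite /subadj uv.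
exact: (subsetP FT).
Qed.

Lemma tau_parent_maps : tau adj = #|parent_map adj r|.
Proof.
rewrite /tau -(card_in_imset parent_edges_inj).
apply: eq_card => T; rewrite inE; apply/asboolP/imsetP.
  by case/spanning_parent_edges => F; exists F.
by case=> F /parent_edges_spanning H ->.
Qed.
End ParentMaps.

(** * The matrix-tree theorem *)

Local Open Scope ring_scope.

Lemma det_functional_graph (R : idomainType) (V : finType) (r : V) (m : nat)
    (e : 'I_m -> V) (F : V -> V) : bijective e -> F r = r ->
  \det (\matrix_(i, j) ((i == j)%:R - ((e i != r) && (F (e i) == e j))%:R))
  = [forall v, fconnect F v r]%:R :> R.
Proof.
move=> [h eK hK] Fr; case: forallP => [FF|nFF]; last first.
  (* The vertices that never reach [r] form a kernel vector. *)
  apply/eqP; rewrite -det_tr; apply/det0P.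
  exists (\row_j (~~ fconnect F (e j) r)%:R).
    apply/eqP => /rowP E; apply: nFF => v; have := E (h v).
    by rewrite !mxE hK; case: (fconnect F v r) => // /eqP; rewrite oner_eq0.
  apply/rowP => i; rewrite !mxE.
  under eq_bigr => j _ do rewrite !mxE mulrBr.
  rewrite sumrB (bigD1 i) //= eqxx mulr1 big1 ?addr0; last first.
    by move=> j; rewrite eq_sym => /negPf ->; rewrite mulr0.
  case: (eqVneq (e i) r) => [->|ir] /=.
    by rewrite connect0 big1 ?subr0 // => j _; rewrite mulr0.
  rewrite (bigD1 (h (F (e i)))) //= hK eqxx mulr1 big1 ?addr0; last first.
    move=> j ji; case: eqP => [E|]; last by rewrite mulr0.
    by rewrite E eK eqxx in ji.
  suff -> : fconnect F (e i) r = fconnect F (F (e i)) r by rewrite subrr.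
  apply/idP/idP; last exact/connect_trans/fconnect1.
  move/iter_findex; case: findex => [/= E|k]; first by rewrite E eqxx in ir.
  by rewrite iterSr => <-; apply: fconnect_iter.
have [d dF] := fconnect_rank FF.
rewrite /determinant (bigD1 (1%g : 'S_m)) //= [X in _ + X]big1 => [|s s1].
  rewrite addr0 odd_perm1 mul1r big1 // => i _; rewrite !mxE perm1 eqxx.
  case: (eqVneq (e i) r) => [_|ir] /=; first by rewrite subr0.
  by case: eqP => [E|]; rewrite ?subr0 //; have := dF _ ir; rewrite E ltnn.
(* A moved index [i] in a nonzero term has [e (s i) = F (e i)], so [s] would
   lower the rank forever. *)
suff [i Hi] : exists i, (s i != i) && ~~ ((e i != r) && (F (e i) == e (s i))).
  rewrite (bigD1 i) //= mxE eq_sym; case/andP: Hi => /negPf -> /negPf ->.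
  by rewrite subrr mul0r mulr0.
apply/existsP; apply: contraT; rewrite negb_exists => /forallP H.
have [i si] : exists i, s i != i.
  apply/existsP; apply: contraR s1; rewrite negb_exists => /forallP E.
  by apply/eqP/permP => i; rewrite perm1; apply/eqP; have := E i; rewrite negbK.
have [k] := ubnP (d (e i)); elim: k i si => // k IH i si di.
have := H i; rewrite si negbK => /andP [ir /eqP E].
apply: (IH (s i)); first by rewrite (inj_eq perm_inj).
by rewrite -E; apply: leq_trans (dF _ ir) di.
Qed.

(** The numbering [e] stays a parameter so that the ladder can use one that exposes a block
    structure. *)
Definition laplacian (R : nzRingType) (V : finType) (adj : rel V) (m : nat)
    (e : 'I_m -> V) : 'M[R]_m :=
  \matrix_(i, j) ((i == j)%:R * (\sum_u (adj (e i) u)%:R) - (adj (e i) (e j))%:R).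

Lemma det_rooted_laplacian (R : idomainType) (V : finType) (adj : rel V) (r : V)
    (m : nat) (e : 'I_m -> V) :
  symmetric adj -> irreflexive adj -> bijective e ->
  \det (\matrix_(i, j) if e i == r then (i == j)%:R else laplacian R adj e i j)
  = (tau adj)%:R.
Proof.
move=> adj_sym adj_irr ebij; have [h eK hK] := ebij.
rewrite (tau_parent_maps r adj_sym adj_irr) -sum1_card.
(* [w v u] is the weight of choosing [u] as parent of [v], the root being forced to choose itself;
   [N i u] is row [i] of the matrix after that choice. *)
pose w v u : R := (if v == r then u == r else adj v u)%:R.
pose N i u j : R := (i == j)%:R - ((e i != r) && (u == e j))%:R.
have E i j : (if e i == r then (i == j)%:R else laplacian R adj e i j)
    = \sum_u w (e i) u * N i u j.
  rewrite /w /N; case: eqP => [_|_] /=.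
    rewrite (bigD1 r) //= eqxx mul1r subr0 big1 ?addr0 // => u /negPf ->.
    by rewrite mul0r.
  rewrite mxE; under [RHS]eq_bigr do rewrite mulrBr.
  rewrite sumrB -mulr_suml mulrC; congr (_ - _).
  rewrite (bigD1 (e j)) //= eqxx mulr1 big1 ?addr0 // => u /negPf ->.
  by rewrite mulr0.
(* Multilinearity in the rows: distributing the product over the row sums gives a sum over all
   parent choices [F]. *)
transitivity (\sum_(F : {ffun V -> V}) (\prod_v w v (F v)) *
    \det (\matrix_(i, j) N i (F (e i)) j)).
  rewrite /determinant; under eq_bigr => s _.
    under eq_bigr do rewrite mxE E.
    rewrite bigA_distr_bigA mulr_sumr /=; over.
  rewrite exchange_big /=.
  rewrite (reindex (fun F : {ffun V -> V} => [ffun i => F (e i)])) /=; last first.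
    exists (fun f : {ffun 'I_m -> V} => [ffun v => f (h v)]) => f _;
    by apply/ffunP => x; rewrite !ffunE ?eK ?hK.
  apply: eq_bigr => F _; rewrite mulr_sumr; apply: eq_bigr => s _.
  rewrite big_split /= mulrCA; congr (_ * (_ * _)).
    rewrite (reindex e); last by exists h => x _; rewrite ?eK ?hK.
    by apply: eq_bigr => i _; rewrite ffunE.
  by apply: eq_bigr => i _; rewrite ffunE mxE.
(* The weight of [F] is 1 if [F] fixes [r] and follows edges elsewhere, and 0 otherwise; the
   determinant tests the remaining condition of [parent_map]. *)
rewrite natr_sum [RHS]big_mkcond /=; apply: eq_bigr => F _.
rewrite unfold_in /parent_map.
case: eqP => [Fr|Fr] /=; last first.
  rewrite (bigD1 r) //= /w eqxx; case: eqP => // _.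
  by rewrite mul0r mul0r.
case: forallP => [Fa|nFa] /=; last first.
  have [v] : exists v, ~~ ((v != r) ==> adj v (F v)).
    by apply/existsP; rewrite -negb_forall; apply/forallP.
  rewrite negb_imply => /andP [/negPf vr /negPf va].
  by rewrite (bigD1 v) //= /w vr va !mul0r.
rewrite big1 ?mul1r => [|v _]; last first.
  by rewrite /w; case: eqVneq => [->|vr]; rewrite ?Fr ?eqxx // (implyP (Fa v)).
by rewrite det_functional_graph //; case: ifP.
Qed.

(* [A] below is [[1, -1], [1, I]], and [L + c J = A * diag(c, L') * A^T]. *)
Lemma det_add_const (R : comNzRingType) (m : nat) (L : 'M[R]_(1 + m)) (c : R) :
  L *m const_mx 1 = 0 :> 'cV_(1 + m) -> const_mx 1 *m L = 0 :> 'rV_(1 + m) ->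
  \det (L + const_mx c) = c * m.+1%:R ^+ 2 * \det (drsubmx L).
Proof.
move=> Lr Lc.
pose u : 'cV[R]_m := const_mx 1; pose D := drsubmx L.
pose A : 'M[R]_(1 + m) := block_mx 1%:M (- u^T) u 1%:M.
have uu : u^T *m u = m%:R%:M.
  apply/matrixP => i j; rewrite !mxE !ord1 eqxx.
  under eq_bigr do rewrite !mxE mul1r.
  by rewrite sumr_const card_ord.
have detA : \det A = m.+1%:R.
  (* The unitriangular factor clears the upper right block of [A] and leaves [1 + m] in the
     corner. *)
  have := det_mulmx (block_mx 1%:M u^T 0 1%:M) A.
  rewrite mulmx_block det_ublock !det1 !mul1r !mul1mx mulmx1 uu addNr.
  rewrite !mul0mx !add0r det_lblock det1 mulr1 => <-.
  by rewrite det_mx11 !mxE eqxx -natr1 addrC.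
have -> : L + const_mx c = A *m block_mx c%:M 0 0 D *m A^T.
  have cu : (const_mx 1 : 'cV[R]_(1 + m)) = col_mx 1%:M u.
    by rewrite -[LHS]vsubmxK; congr col_mx; apply/matrixP => i j; rewrite !mxE ?ord1.
  have ru : (const_mx 1 : 'rV[R]_(1 + m)) = row_mx 1%:M u^T.
    by rewrite -[LHS]hsubmxK; congr row_mx; apply/matrixP => i j; rewrite !mxE ?ord1.
  (* Zero row and column sums express the other blocks of [L] through [D]: they are [- D u],
     [- u^T D] and [u^T D u]. *)
  move: Lr Lc; rewrite cu ru -{1 2}[L]submxK mul_block_col mul_row_block.
  rewrite !mulmx1 !mul1mx.
  rewrite -[0 in X in X -> _]vsubmxK -[0 in X in _ -> X -> _]hsubmxK.
  case/eq_col_mx => + Hdl /eq_row_mx [_ Hur].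
  rewrite linear0 => /eqP; rewrite addr_eq0 => /eqP Hul.
  move: Hdl Hur; rewrite !linear0 => /eqP; rewrite addr_eq0 => /eqP Hdl.
  move=> /eqP; rewrite addr_eq0 => /eqP Hur.
  rewrite /A tr_block_mx !trmx1 linearN /= trmxK !mulmx_block.
  rewrite !mul1mx !mulmx1 !mulmx0 !addr0 !add0r.
  rewrite -{1}[L]submxK Hul Hdl Hur -/D.
  have -> : const_mx c =
      block_mx c%:M (c *: u^T) (c *: u) (c *: (u *m u^T)) :> 'M_(1 + m).
    rewrite -[LHS]submxK; congr block_mx; apply/matrixP => i j;
      rewrite !mxE ?ord1 ?mulr1 //.
    by rewrite big_ord1 !mxE !mulr1.
  rewrite add_block_mx; congr block_mx.
  - by rewrite !mulNmx !mulmxN opprK addrC.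
  - by rewrite !mulNmx mul_scalar_mx addrC.
  - by rewrite !mulmxN mul_mx_scalar addrC.
  - by rewrite mul_mx_scalar -scalemxAl addrC.
rewrite !det_mulmx det_tr detA det_ublock det_scalar expr1; ring.
Qed.

(** Rows and columns of the Laplacian sum to zero, so [det_add_const] applies. With root [e ord0]
    the rooted matrix is block lower triangular with corner 1, so its determinant is the minor that
    appears there. *)
Lemma det_laplacian_add_const (R : idomainType) (V : finType) (adj : rel V)
    (m : nat) (e : 'I_m.+1 -> V) (c : R) :
  symmetric adj -> irreflexive adj -> bijective e ->
  \det (laplacian R adj e + const_mx c) = c * m.+1%:R ^+ 2 * (tau adj)%:R.
Proof.
move=> adj_sym adj_irr ebij; have [h eK hK] := ebij.
have rowE i : \sum_j laplacian R adj e i j = 0.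
  under eq_bigr do rewrite mxE.
  rewrite sumrB -mulr_suml (bigD1 i) //= eqxx big1 ?addr0 => [|j]; last first.
    by rewrite eq_sym => /negPf ->.
  rewrite mul1r (reindex e) ?subrr //.
  by exists h => x _; rewrite ?eK ?hK.
have Lsym i j : laplacian R adj e i j = laplacian R adj e j i.
  by rewrite !mxE adj_sym eq_sym; case: eqP => [->|]; rewrite ?mul0r.
rewrite (@det_add_const _ m).
- congr (_ * _); rewrite -(det_rooted_laplacian R (e ord0) adj_sym adj_irr ebij).
  set M : 'M_(1 + m) := matrix_of_fun _ _.
  have l0 : lshift m (0 : 'I_1) = ord0 by apply: val_inj.
  have -> : M = block_mx (1%:M : 'M_1) 0 (dlsubmx M)
                         (drsubmx (laplacian R adj e : 'M_(1 + m))).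
    rewrite -[LHS](@submxK _ 1 m 1 m); congr block_mx; apply/matrixP => i j;
      rewrite !mxE.
    + by rewrite !ord1 l0 !eqxx.
    + by rewrite !ord1 l0 eqxx.
    + by rewrite (can_eq eK).
  by rewrite (@det_lblock _ 1 m) det1 mul1r.
- apply/matrixP => i j; rewrite !mxE -[RHS](rowE i).
  by apply: eq_bigr => k _; rewrite [const_mx _ _ _]mxE mulr1.
- apply/matrixP => i j; rewrite !mxE -[RHS](rowE j).
  by apply: eq_bigr => k _; rewrite [const_mx _ _ _]mxE mul1r Lsym.
Qed.

(** Adding the second block row to the first, then subtracting the first block column from the
    second, leaves a block lower triangular matrix. *)
Lemma det_block_sym (R : comNzRingType) (n : nat) (X Y : 'M[R]_n) :
  \det (block_mx X Y Y X) = \det (X + Y) * \det (X - Y).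
Proof.
pose P : 'M[R]_(n + n) := block_mx 1%:M 1%:M 0 1%:M.
pose Q : 'M[R]_(n + n) := block_mx 1%:M (- 1%:M) 0 1%:M.
have E : P *m block_mx X Y Y X *m Q = block_mx (X + Y) 0 Y (X - Y).
  rewrite /P /Q !mulmx_block !mul1mx !mul0mx !mulmx0 !mulmx1 !mulmxN !mulmx1.
  by rewrite !add0r !addr0 [Y + X]addrC addNr [- Y + X]addrC.
by rewrite -(det_lblock _ Y) -E !det_mulmx !det_ublock !det1 !mul1r mulr1.
Qed.

(** * Twisted cyclic shifts *)

(** [s] is the factor picked up on wrapping around: 1 gives the periodic shift, -1 the antiperiodic
    one. *)
Definition twisted_shift (R : nzRingType) (k : nat) (s : R) : 'M[R]_k.+1 :=
  \matrix_(i, j) ((if i == ord_max then s else 1) * (ordS i == j)%:R).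

Section TwistedShift.
Variables (R : comNzRingType) (k : nat).
Implicit Types s x : R.

Lemma twisted_shiftE s (i j : 'I_k.+1) : twisted_shift k s i j =
  (i.+1 == j :> nat)%:R + s * ((i == k :> nat) && (j == 0 :> nat))%:R.
Proof.
rewrite mxE -!val_eqE /=; case: eqVneq => [->|ik].
  rewrite modnn eq_sym; case: eqVneq => [->|_] /=; first by rewrite add0r.
  by rewrite !mulr0 addr0; case: eqP => // E; have := ltn_ord j; rewrite -E ltnn.
by rewrite modn_small ?mul1r ?mulr0 ?addr0 //; have := ltn_ord i; lia.
Qed.

Lemma twisted_shift_unitary s : s ^+ 2 = 1 ->
  twisted_shift k s *m (twisted_shift k s)^T = 1%:M.
Proof.
move=> s2; apply/matrixP => i j; rewrite !mxE (bigD1 (ordS i)) //= big1 => [|l li].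
  rewrite !mxE eqxx addr0 mulr1 (inj_eq (@ordS_inj _)) [j == i]eq_sym.
  case: (eqVneq i j) => [->|_]; last by rewrite !mulr0.
  by rewrite mulr1; case: ifP; rewrite ?mulr1 // -expr2.
by rewrite !mxE [ordS i == l]eq_sym (negPf li) !mulr0 mul0r.
Qed.

(** Deleting row and column 0 removes the wrap-around entry, and what is left is upper
    unitriangular. *)
Lemma det_drsubmx_twisted_shift s x :
  \det (drsubmx (1%:M - x *: twisted_shift k s : 'M_(1 + k))) = 1.
Proof.
have E (i j : 'I_k) : drsubmx (1%:M - x *: twisted_shift k s : 'M_(1 + k)) i j
    = (i == j)%:R - x * (i.+1 == j :> nat)%:R.
  rewrite !mxE -!val_eqE /= !add1n eqSS.
  case: (eqVneq i.+1 k) => [ik|ik].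
    by rewrite ik modnn (gtn_eqF (ltn_ord j)) !mulr0.
  by rewrite modn_small ?mul1r ?eqSS //; have := ltn_ord i; lia.
rewrite -det_tr det_trig.
  by rewrite big1 // => i _; rewrite mxE E eqxx gtn_eqF // mulr0 subr0.
apply/is_trig_mxP => i j ij; rewrite mxE E -!val_eqE /=.
by rewrite !gtn_eqF ?mulr0 ?subr0 // ltnW.
Qed.

(* Adding to row 0 the rows [x ^+ i * row i] clears it except for its first entry. *)
Lemma det_twisted_shift s x :
  \det (1%:M - x *: twisted_shift k s) = 1 - s * x ^+ k.+1.
Proof.
pose M : 'M[R]_(1 + k) := 1%:M - x *: twisted_shift k s.
pose u : 'rV[R]_k := \row_j x ^+ j.+1.
pose B : 'M[R]_(1 + k) := block_mx 1%:M u 0 1%:M.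
have rowB (j : 'I_(1 + k)) : B 0 j = x ^+ j.
  have l0 : (0 : 'I_k.+1) = lshift k (0 : 'I_1) by apply: val_inj.
  by rewrite l0 /B /block_mx col_mxEu mxE; case: splitP => j0 ->; rewrite mxE ?ord1 ?eqxx.
have BM : row 0 (B *m M) = row_mx (1 - s * x ^+ k.+1)%:M 0.
  apply/rowP => j; rewrite !mxE.
  under eq_bigr => i _ do rewrite rowB !mxE mulrBr.
  rewrite sumrB (bigD1 j) //= eqxx mulr1 big1 ?addr0; last first.
    by move=> i /negPf ->; rewrite mulr0.
  (* Column [j] meets the shift only in row [ord_pred j]. For [j > 0] the terms [x ^+ j] and
     [x * x ^+ j.-1] cancel; for [j = 0] that row is [k], which contributes [s * x ^+ k.+1]. *)
  rewrite (bigD1 (ord_pred j)) //= ord_predK eqxx mulr1 big1 ?addr0; last first.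
    move=> i ij; rewrite -[j]ord_predK (inj_eq (@ordS_inj _)) (negPf ij).
    by rewrite !mulr0.
  rewrite -val_eqE /= (_ : (j + (1 + k)).-1 = j + k)%N; last by rewrite addnA addn1 addSn.
  case: splitP => j0 ->; rewrite ?add1n.
    rewrite ord1 mxE eqxx mulr1n add0n modn_small // eqxx exprS expr0; ring.
  rewrite mxE addSnnS modnDr modn_small; last by rewrite ltnW // ltnS.
  by rewrite ltn_eqF // mulr1 exprSr subrr.
have lowB : dsubmx (B *m M) = dsubmx M.
  rewrite -mul_dsub_mx /B /block_mx col_mxKd -{1}[M]vsubmxK mul_row_col.
  by rewrite mul0mx add0r mul1mx.
have detB : \det B = 1 by rewrite det_ublock !det1 mulr1.
have E : B *m M = block_mx (1 - s * x ^+ k.+1)%:M 0 (dlsubmx M) (drsubmx M).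
  rewrite -[LHS]vsubmxK lowB /block_mx hsubmxK; congr col_mx.
  rewrite -BM; apply/rowP => j; rewrite !mxE; apply: eq_bigr => i _.
  by congr (B _ _ * _); apply: val_inj.
have := det_mulmx B M; rewrite detB mul1r E det_lblock.
by rewrite /M det_drsubmx_twisted_shift mulr1 det_mx11 mxE eqxx mulr1n => ->.
Qed.

(** As [s ^+ 2 = 1], the shift is orthogonal and the quadratic term is scalar. This factors the
    periodic matrix at [x = 1] and the antiperiodic one at [x = q]. *)
Lemma twisted_shift_quadratic s x : s ^+ 2 = 1 ->
  (1%:M - x *: twisted_shift k s) *m (1%:M - x *: twisted_shift k s)^T =
  (1 + x ^+ 2)%:M - x *: (twisted_shift k s + (twisted_shift k s)^T).
Proof.
move=> s2; rewrite [(_ - _)^T]linearB /= [(x *: _)^T]linearZ /= trmx1.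
rewrite mulmxBl mul1mx mulmxBr mulmx1.
rewrite -scalemxAl -scalemxAr twisted_shift_unitary // scalerA scalerDr opprD.
rewrite scale_scalar_mx mulr1 -expr2 raddfD /=; apply/matrixP => i j; rewrite !mxE; ring.
Qed.

Lemma twisted_shift_row_sum i : \sum_j twisted_shift k 1 i j = 1 :> R.
Proof.
rewrite (bigD1 (ordS i)) //= big1 ?addr0 => [|j]; rewrite mxE.
  by case: ifP; rewrite eqxx mul1r.
by rewrite eq_sym => /negPf ->; rewrite mulr0.
Qed.

Lemma twisted_shift_col_sum j : \sum_i twisted_shift k 1 i j = 1 :> R.
Proof.
rewrite (bigD1 (ord_pred j)) //= big1 ?addr0 => [|i ij]; rewrite mxE.
  by rewrite ord_predK; case: ifP; rewrite eqxx mul1r.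
by rewrite -[j]ord_predK (inj_eq (@ordS_inj _)) (negPf ij) mulr0.
Qed.

(* The periodic shift [S] fixes the all-ones matrix [J], [S J = J S = J], so
   [2 - S - S^T + nJ = (1 - S + J)(1 - S + J)^T]. *)
Lemma det_cycle_add_const :
  \det (2%:M - (twisted_shift k 1 + (twisted_shift k 1)^T) + const_mx k.+1%:R)
  = k.+1%:R ^+ 4 :> R.
Proof.
pose S : 'M[R]_k.+1 := twisted_shift k 1; pose J : 'M[R]_k.+1 := const_mx 1.
pose D : 'M[R]_k.+1 := 1%:M - 1 *: S.
have SJ : S *m J = J.
  apply/matrixP => i j; rewrite !mxE -[RHS](twisted_shift_row_sum i).
  by apply: eq_bigr => l _; rewrite [J _ _]mxE mulr1.
have JS : J *m S = J.
  apply/matrixP => i j; rewrite !mxE -[RHS](twisted_shift_col_sum j).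
  by apply: eq_bigr => l _; rewrite [J _ _]mxE mul1r.
have DJ : D *m J = 0 by rewrite mulmxBl mul1mx scale1r SJ subrr.
have JD : J *m D = 0 by rewrite mulmxBr mulmx1 scale1r JS subrr.
have JT : J^T = J by apply/matrixP => i j; rewrite !mxE.
have JJ : J *m J = const_mx k.+1%:R.
  apply/matrixP => i j; rewrite !mxE; under eq_bigr do rewrite !mxE mul1r.
  by rewrite sumr_const card_ord.
have JDT : J *m D^T = 0 by rewrite -JT -trmx_mul DJ trmx0.
have -> : 2%:M - (S + S^T) + const_mx k.+1%:R = (D + J) *m (D + J)^T.
  rewrite [(D + J)^T]linearD /= JT mulmxDl !mulmxDr DJ JDT addr0 add0r JJ.
  by rewrite twisted_shift_quadratic ?expr1n // scale1r.
(* [det_add_const] serves a second time, on [D] with constant 1, where the minor is 1. *)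
have detDJ : \det (D + J) = k.+1%:R ^+ 2.
  rewrite (@det_add_const _ k); last first.
  - by move/(congr1 (row 0)): JD; rewrite row_mul row_const linear0.
  - by move/(congr1 (col 0)): DJ; rewrite !colE -mulmxA mul0mx -colE col_const.
  by rewrite det_drsubmx_twisted_shift mul1r mulr1.
by rewrite det_mulmx det_tr detDJ -exprD.
Qed.

Lemma det_antiperiodic (p q : R) : p * q = 1 ->
  \det ((p + q)%:M - (twisted_shift k (-1) + (twisted_shift k (-1))^T))
  = p ^+ k.+1 + q ^+ k.+1 + 2.
Proof.
move=> pq; set W := twisted_shift k (-1).
have -> : (p + q)%:M - (W + W^T) = p *: ((1%:M - q *: W) *m (1%:M - q *: W)^T).
  rewrite twisted_shift_quadratic ?sqrrN ?expr1n // scalerBr scalerA pq scale1r.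
  by rewrite scale_scalar_mx mulrDr mulr1 expr2 mulrA pq mul1r.
rewrite detZ det_mulmx det_tr det_twisted_shift.
have : p ^+ k.+1 * q ^+ k.+1 = 1 by rewrite -exprMn pq expr1n.
move: (p ^+ _) (q ^+ _) => a b ab; rewrite mulN1r opprK.
by transitivity (a + 2 * (a * b) + (a * b) * b); [ring | rewrite ab; ring].
Qed.
End TwistedShift.

(** * The Moebius polyomino network *)

(** Unprimed vertices come first, so exchanging i and i' swaps the two halves and the Laplacian has
    equal diagonal blocks and equal off-diagonal blocks. *)
Definition ladder_vertex (n : nat) (i : 'I_(n + n)) : mvert n :=
  match split i with inl j => (j, false) | inr j => (j, true) end.

Lemma ladder_vertex_bij (n : nat) : bijective (@ladder_vertex n).
Proof.
exists (fun v : mvert n => unsplit (if v.2 then inr v.1 else inl v.1)).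
  by move=> i; rewrite -[RHS]splitK /ladder_vertex; case: (split i).
by case=> j []; rewrite /ladder_vertex unsplitK.
Qed.

Lemma madj_sym (n : nat) : symmetric (@madj n).
Proof.
move=> [i a] [j b]; rewrite /madj [a == b]eq_sym [i == j]eq_sym.
by congr [|| _ && _, _ | _ && _]; exact: orbC.
Qed.

Lemma madj_irr (n : nat) : irreflexive (@madj n).
Proof. by move=> [i a]; rewrite /madj !eqxx /= orbF; apply/negbTE; lia. Qed.

Section Moebius.
Variables (R : idomainType) (k : nat).
Hypothesis k_ge2 : (2 <= k)%N.
Let S : 'M[R]_k.+1 := twisted_shift k 1.
Let W : 'M[R]_k.+1 := twisted_shift k (-1).

(** On vectors with equal values at i and i', the crossing edges act like edges closing an n-cycle,
    whence the periodic shift; the diagonal term is the rung. *)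
Lemma madj_add i j :
  (madj (i, false) (j, false))%:R + (madj (i, false) (j, true))%:R
  = (i == j)%:R + (S + S^T) i j.
Proof.
rewrite mxE [S^T _ _]mxE !twisted_shiftE /madj /= -val_eqE /=.
have := ltn_ord i; have := ltn_ord j.
by do ! (case: eqP => ? /=); do ?lia; move=> _ _; ring.
Qed.

(** On vectors changing sign between i and i', crossing edges and rungs count negatively: the
    wrap-around becomes antiperiodic and the diagonal term is -1. *)
Lemma madj_sub i j :
  (madj (i, false) (j, false))%:R - (madj (i, false) (j, true))%:R
  = (W + W^T) i j - (i == j)%:R.
Proof.
rewrite mxE [W^T _ _]mxE !twisted_shiftE /madj /= -val_eqE /=.
have := ltn_ord i; have := ltn_ord j.
by do ! (case: eqP => ? /=); do ?lia; move=> _ _; ring.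
Qed.

Lemma madj_degree (v : mvert k.+1) : \sum_u (madj v u)%:R = 3 :> R.
Proof.
case: v => i a.
have -> : \sum_u (madj (i, a) u)%:R = \sum_j ((i == j)%:R + (S + S^T) i j) :> R.
  transitivity (\sum_j \sum_b (madj (i, a) (j, b))%:R : R).
    by rewrite pair_bigA; apply: eq_bigr => -[].
  apply: eq_bigr => j _; rewrite -madj_add big_bool /=.
  by case: a => //; rewrite addrC.
rewrite big_split /= (bigD1 i) //= eqxx big1 => [|j]; last first.
  by rewrite eq_sym => /negPf ->.
under eq_bigr do rewrite mxE [S^T _ _]mxE.
rewrite big_split /= twisted_shift_row_sum twisted_shift_col_sum; ring.
Qed.

Lemma det_moebius_laplacian (p q c : R) : p * q = 1 -> p + q = 4 -> 2 * c = k.+1%:R ->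
  \det (laplacian R (@madj k.+1) (@ladder_vertex k.+1) + const_mx c)
  = k.+1%:R ^+ 4 * (p ^+ k.+1 + q ^+ k.+1 + 2).
Proof.
move=> pq1 pq4 c2.
pose X : 'M[R]_k.+1 := \matrix_(i, j)
  ((i == j)%:R * 3 - (madj (i, false) (j, false))%:R + c).
pose Y : 'M[R]_k.+1 := \matrix_(i, j) (- (madj (i, false) (j, true))%:R + c).
have -> : laplacian R (@madj k.+1) (@ladder_vertex k.+1) + const_mx c = block_mx X Y Y X.
  rewrite -[LHS]submxK; congr block_mx; apply/matrixP => i j;
    rewrite !mxE madj_degree /ladder_vertex ?(unsplitK (inl _)) ?(unsplitK (inr _));
    rewrite ?(inj_eq (@lshift_inj _ _)) ?(inj_eq (@rshift_inj _ _)) //.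
  - by rewrite eq_lrshift mul0r add0r.
  - by rewrite eq_rlshift mul0r add0r.
(* In [X + Y] the degree 3 loses the rung, leaving 2, and the constant is [2 * c], that is n. In
   [X - Y] the constant cancels and the diagonal is 3 + 1 = [p + q]. *)
rewrite det_block_sym; congr (_ * _).
- rewrite -det_cycle_add_const; congr (\det _); apply/matrixP => i j.
  have E := madj_add i j; rewrite mxE [X i j]mxE [Y i j]mxE.
  rewrite [RHS]mxE [const_mx _ i j]mxE [X in _ = X + _]mxE.
  rewrite [2%:M i j]mxE [X in _ = _ + X + _]mxE -mulr_natr -c2.
  rewrite -[LHS](_ : (i == j)%:R * 3 - ((i == j)%:R + (S + S^T) i j) + 2 * c = _).
    by rewrite -/S; ring.
  by rewrite -E; ring.
- rewrite -(det_antiperiodic _ pq1) pq4; congr (\det _); apply/matrixP => i j.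
  have E := madj_sub i j; rewrite mxE [X i j]mxE [(- Y) i j]mxE [Y i j]mxE.
  rewrite [RHS]mxE [4%:M i j]mxE [X in _ = _ + X]mxE -mulr_natr.
  rewrite -[LHS](_ : (i == j)%:R * 3 - ((W + W^T) i j - (i == j)%:R) = _).
    by rewrite -/W; ring.
  by rewrite -E; ring.
Qed.
End Moebius.

Theorem theorem3p4 (R : rcfType) (n : nat) : (3 <= n)%N ->
  let p : R := 2 + Num.sqrt 3 in
  let q : R := 2 - Num.sqrt 3 in
  (tau (@madj n))%:R = n%:R / 2 * (p ^+ n + q ^+ n + 2).
Proof.
case: n => [//|k] k2 p q.
have pq1 : p * q = 1.
  by rewrite /p /q mulrC -subr_sqr sqr_sqrtr ?ler0n //; ring.
have pq4 : p + q = 4 by rewrite /p /q; ring.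
pose c : R := k.+1%:R / 2.
have c2 : 2 * c = k.+1%:R by rewrite /c; field.
have := det_moebius_laplacian k2 pq1 pq4 c2.
rewrite (@det_laplacian_add_const _ _ _ (k + k.+1)); last first.
- exact: ladder_vertex_bij.
- exact: madj_irr.
- exact: madj_sym.
have -> : (k + k.+1).+1%:R = 2 * k.+1%:R :> R by rewrite -natrM; congr _%:R; lia.
(* With [c] equal to n / 2 and 2n vertices, the factor of [tau] is c (2n)^2 = 2 n^3, which is
   nonzero and can be cancelled. *)
move=> E; apply: (@mulfI _ (2 * k.+1%:R ^+ 3)).
  by rewrite mulf_neq0 ?expf_neq0 ?pnatr_eq0.
transitivity (c * (2 * k.+1%:R) ^+ 2 * (tau (@madj k.+1))%:R).
  by rewrite /c; field.
by rewrite E; field.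
Qed.
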